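(* If $f\in\mathcal{A}_c(\mathbb{T})$ and $g\in\mathcal{BV}(\mathbb{T})$ then $$g[f]=\langle f,g\rangle=\int_{-\pi}^{\pi}fg=\lim_{n\to\infty}\sum_{k=-n}^n\left(1-\frac{|k|}{n+1}\right)\hat f(k)\,\hat g(k).$$
   Context: ''Periodic'' means $2\pi$-periodic. $\mathcal{B}_c(\mathbb{T})$ is the set of continuous $F:\mathbb{R}\to\mathbb{R}$ with $F(-\pi)=0$ and $F(y+2n\pi)=F(y)+nF(\pi)$ for all $y\in[-\pi,\pi)$, $n\in\mathbb{Z}$. $\mathcal{A}_c(\mathbb{T})$ is the set of Schwartz distributions $f$ on $\mathbb{R}$ such that $f=F'$ (distributional derivative) for some $F\in\mathcal{B}_c(\mathbb{T})$; this $F$ is unique and is called the primitive of $f$. For periodic $g:\mathbb{R}\to\mathbb{R}$ the variation is $Vg=\sup\sum_i|g(s_i)-g(t_i)|$, the supremum over all families of disjoint intervals $(s_i,t_i)\subset(-\pi,\pi)$, and $\mathcal{BV}(\mathbb{T})$ is the set of periodic functions with finite variation. For $f\in\mathcal{A}_c(\mathbb{T})$ with primitive $F$ and $g\in\mathcal{BV}(\mathbb{T})$, the continuous primitive integral of the product is $\int_{-\pi}^{\pi}fg=F(\pi)g(\pi)-\int_{-\pi}^{\pi}F\,dg$ (Riemann--Stieltjes integral); for complex-valued integrands the real and imaginary parts are integrated separately. The notations $g[f]$ and $\langle f,g\rangle$ both denote $\int_{-\pi}^{\pi}fg$, where $g$ is viewed as a continuous linear functional on $\mathcal{A}_c(\mathbb{T})$.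 Fourier coefficients are unnormalized: $\hat f(k)=\int_{-\pi}^{\pi}f(t)e^{-ikt}\,dt$ for $k\in\mathbb{Z}$ (continuous primitive integral), and likewise $\hat g(k)=\int_{-\pi}^{\pi}g(t)e^{-ikt}\,dt$.
   Formalization: The printed formula fails (f=g=1 gives 2π against 4π²; f=g=sin gives π against −2π²); the formal statement multiplies the sum by 1/(2π) and replaces ĝ(k) by its complex conjugate, with hypotheses, weights and limit unchanged. *)

(* Defs.v *)
From Stdlib Require Import Reals ZArith ClassicalEpsilon.
From Coquelicot Require Import Coquelicot.

Open Scope R_scope.

(** * Schwartz distributions on the real line *)

Record test_function := TestFunction {
  test_fun :> R -> R;
  test_smooth : forall (n : nat) (x : R), ex_derive_n test_fun n x;
  test_supp : exists A : R, forall x : R, A < Rabs x -> test_fun x = 0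
}.

(** Convergence in the space of test functions: the supports lie in a common
    compact set and every derivative converges uniformly. *)
Definition test_cvg (phi : nat -> test_function) (psi : test_function) : Prop :=
  (exists A : R, forall (n : nat) (x : R), A < Rabs x -> phi n x = 0) /\
  (forall (m : nat) (eps : R), 0 < eps ->
     exists N : nat, forall n : nat, (N <= n)%nat ->
       forall x : R, Rabs (Derive_n (phi n) m x - Derive_n psi m x) < eps).

Record distribution := Distribution {
  pairing :> test_function -> R;
  pairing_linear : forall (a b : R) (phi psi chi : test_function),
    (forall x : R, chi x = a * phi x + b * psi x) ->
    pairing chi = a * pairing phi + b * pairing psi;
  pairing_continuous : forall (phi : nat -> test_function) (psi : test_function),
    test_cvg phi psi -> is_lim_seq (fun n => pairing (phi n)) (pairing psi)
}.

(** [f = F'] in the sense of distributions, for continuous [F]. *)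
Definition is_distr_derivative (F : R -> R) (f : distribution) : Prop :=
  forall phi : test_function,
    is_RInt_gen (fun x => F x * Derive phi x)
      (Rbar_locally m_infty) (Rbar_locally p_infty) (- f phi).

(** * The spaces B_c(T) and A_c(T) *)

Definition Bc (F : R -> R) : Prop :=
  (forall x : R, continuous F x) /\
  F (- PI) = 0 /\
  (forall (y : R) (n : Z), - PI <= y < PI ->
     F (y + 2 * IZR n * PI) = F y + IZR n * F PI).

Definition Ac (f : distribution) : Prop :=
  exists F : R -> R, Bc F /\ is_distr_derivative F f.

(** The element of [Bc] whose derivative is [f]; a junk value unless [Ac f]. *)
Definition distr_primitive (f : distribution) : R -> R :=
  epsilon (inhabits (fun _ : R => 0))
    (fun F : R -> R => Bc F /\ is_distr_derivative F f).

(** * Periodic functions of bounded variation *)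

Definition periodic (g : R -> R) : Prop :=
  forall x : R, g (x + 2 * PI) = g x.

(** The intervals are [(s i, t i)] for [i <= n]. As they are open, being
    included in [(-PI, PI)] still allows the endpoints [-PI] and [PI]. *)
Definition disjoint_intervals (n : nat) (s t : nat -> R) : Prop :=
  (forall i : nat, (i <= n)%nat ->
     s i < t i /\ (forall x : R, s i < x < t i -> - PI < x < PI)) /\
  (forall i j : nat, (i <= n)%nat -> (j <= n)%nat -> i <> j ->
     forall x : R, ~ (s i < x < t i /\ s j < x < t j)).

Definition variation (g : R -> R) : Rbar :=
  Lub_Rbar (fun v : R => exists (n : nat) (s t : nat -> R),
    disjoint_intervals n s t /\
    v = sum_n (fun i => Rabs (g (s i) - g (t i))) n).

Definition BV (g : R -> R) : Prop :=
  periodic g /\ is_finite (variation g).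

(** * Riemann-Stieltjes integral *)

(** [RS_sum], [is_RSInt] and [RSInt] mirror [Riemann_sum], [is_RInt] and
    [RInt], with the length of each subinterval replaced by the increment of [g]
    and without the orientation sign: they are meant for [a <= b]. *)
Definition RS_sum (F g : R -> R) (ptd : SF_seq) : R :=
  seq.foldr Rplus 0
    (seq.pairmap (fun x y => (g (fst y) - g (fst x)) * F (snd y))
       (SF_h ptd, 0) (SF_t ptd)).

Definition is_RSInt (F g : R -> R) (a b l : R) : Prop :=
  filterlim (RS_sum F g) (Riemann_fine a b) (locally l).

Definition RSInt (F g : R -> R) (a b : R) : R := iota (is_RSInt F g a b).

(** * The continuous primitive integral and Fourier coefficients *)

Definition cpint (f : distribution) (g : R -> R) : R :=
  distr_primitive f PI * g PI - RSInt (distr_primitive f) g (- PI) PI.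

Definition cpintC (f : distribution) (h : R -> C) : C :=
  (cpint f (fun t => Re (h t)), cpint f (fun t => Im (h t))).

Definition RIntC (h : R -> C) (a b : R) : C :=
  (RInt (fun t => Re (h t)) a b, RInt (fun t => Im (h t)) a b).

(** [expi x] is e^(ix). *)
Definition expi (x : R) : C := (cos x, sin x).

(** Fourier coefficients carry no factor [1 / (2 * PI)]; the Parseval formula
    therefore does, and pairs each coefficient with a conjugate. *)
Definition fourier_distr (f : distribution) (k : Z) : C :=
  cpintC f (fun t => expi (- (IZR k * t))).

Definition fourier_fun (g : R -> R) (k : Z) : C :=
  RIntC (fun t => (g t * expi (- (IZR k * t)))%C) (- PI) PI.

(** The sum of [a k] over the integers [- n <= k <= n]. *)
Definition sum_sym (a : Z -> C) (n : nat) : C :=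
  sum_n (fun j : nat => a (Z.of_nat j - Z.of_nat n)%Z) (2 * n).

(* Main.v *)
Require Import Defs.
From Stdlib Require Import Reals ZArith Lra Lia ClassicalEpsilon.
From Coquelicot Require Import Coquelicot.

(** Let [F] be the primitive of [f] and [c = F PI / (2 * PI)].  Then
    [F t = c * (t + PI) + P t] with [P] continuous and periodic.  Let [Phi n t]
    be [c * (t + PI)] plus the [n]-th Fejér mean of [P].  The proof moves the
    limit from [g], whose Fejér means need not converge uniformly, to [F], where
    the convergence is uniform.

    Integrating by parts in the Fourier coefficients of [f], the [n]-th Cesàro
    sum of the statement is the ordinary integral of [g] against the derivative
    of [Phi n] ([fejer_sum_eq]).  A second integration by parts, valid because
    [g] has bounded variation and [Phi n] is continuously differentiable
    ([is_RSInt_by_parts]), turns it into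

      [Phi n PI * g PI - Phi n (- PI) * g (- PI) - RSInt (Phi n) g (- PI) PI].

    By Fejér's theorem ([fejer_mean_cvg]) [Phi n] tends to [F] uniformly on
    [[- PI, PI]], and a Stieltjes integral against [g] is bounded by the supremum
    of the integrand times the variation of [g], so it passes to uniform limits
    ([is_RSInt_uniform_limit]).  As [F (- PI) = 0], the limit is
    [F PI * g PI - RSInt F g (- PI) PI], which is [cpint f g].

    Integrals given by [RSInt] and [RInt] carry no information until they are known
    to exist.  Both existence results come from one device: the total variation
    of [g] is replaced by a function [v] whose increments bound those of [g]
    ([increments_dominated]), so that error estimates over the pieces of a
    subdivision add up by telescoping. *)

Open Scope R_scope.

(** * Riemann-Stieltjes sums and local error estimates *)

(** The total variation of [g] on [[a, x]] is the least such [v] up to a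
    constant; any other majorant serves as well, and majorants are easier to
    combine than variations. *)
Definition increments_dominated (g v : R -> R) (a b : R) : Prop :=
  forall x y : R, a <= x -> x <= y -> y <= b -> Rabs (g y - g x) <= v y - v x.

Lemma RS_sum_cons (F g : R -> R) (h : R * R) (s : SF_seq) :
  RS_sum F g (SF_cons h s) = (g (SF_h s) - g (fst h)) * F (snd h) + RS_sum F g s.
Proof.
  destruct s as [x0 t]; destruct t as [|p t]; reflexivity.
Qed.

Lemma RS_sum_minus (F G g : R -> R) (s : SF_seq) :
  RS_sum (fun x => F x - G x) g s = RS_sum F g s - RS_sum G g s.
Proof.
  induction s as [x0|h s IH] using SF_cons_ind.
  - unfold RS_sum; simpl; ring.
  - rewrite !RS_sum_cons, IH; ring.
Qed.

Lemma last_SF_cons (h : R * R) (s : SF_seq) :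
  seq.last (SF_h (SF_cons h s)) (SF_lx (SF_cons h s)) = seq.last (SF_h s) (SF_lx s).
Proof. reflexivity. Qed.

Lemma pointed_subdiv_head (h : R * R) (s : SF_seq) :
  pointed_subdiv (SF_cons h s) -> fst h <= snd h <= SF_h s.
Proof. intros Hs; exact (Hs 0%nat (Nat.lt_0_succ _)). Qed.

Lemma pointed_subdiv_bounds (s : SF_seq) :
  pointed_subdiv s -> SF_h s <= seq.last (SF_h s) (SF_lx s).
Proof.
  induction s as [x0|h s IH] using SF_cons_ind; intros Hs.
  - apply Rle_refl.
  - rewrite last_SF_cons.
    change (SF_h (SF_cons h s)) with (fst h).
    generalize (pointed_subdiv_head _ _ Hs) (IH (ptd_cons _ _ Hs)); lra.
Qed.

(** If [J] is a candidate primitive and on each short piece the Stieltjes term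
    differs from the increment of [J] by at most the increment of [w], then both
    sides telescope along the subdivision. *)
Lemma RS_sum_approx (F g J w : R -> R) (delta : R) (s : SF_seq) :
  pointed_subdiv s -> seq_step (SF_lx s) < delta ->
  (forall x xi y : R, SF_h s <= x -> x <= xi -> xi <= y ->
     y <= seq.last (SF_h s) (SF_lx s) -> y - x < delta ->
     Rabs ((g y - g x) * F xi - (J y - J x)) <= w y - w x) ->
  Rabs (RS_sum F g s - (J (seq.last (SF_h s) (SF_lx s)) - J (SF_h s)))
    <= w (seq.last (SF_h s) (SF_lx s)) - w (SF_h s).
Proof.
  induction s as [x0|h s IH] using SF_cons_ind; intros Hs Hd Hloc.
  - unfold RS_sum; simpl.
    replace (0 - (J x0 - J x0)) with 0 by ring.
    rewrite Rabs_R0; lra.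
  - rewrite last_SF_cons in *.
    assert (Hs' := ptd_cons _ _ Hs).
    assert (Hb := pointed_subdiv_bounds _ Hs').
    assert (H0 := pointed_subdiv_head _ _ Hs).
    rewrite RS_sum_cons.
    change (SF_h (SF_cons h s)) with (fst h) in *.
    assert (Hd' : seq_step (SF_lx s) < delta /\ SF_h s - fst h < delta).
    { change (Rmax (Rabs (SF_h s - fst h)) (seq_step (SF_lx s)) < delta) in Hd.
      generalize (Rmax_l (Rabs (SF_h s - fst h)) (seq_step (SF_lx s)))
        (Rmax_r (Rabs (SF_h s - fst h)) (seq_step (SF_lx s)))
        (Rle_abs (SF_h s - fst h)); lra. }
    destruct Hd' as [Hd1 Hd2].
    assert (H1 := Hloc (fst h) (snd h) (SF_h s) (Rle_refl _) (proj1 H0) (proj2 H0) Hb Hd2).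
    assert (H2 : Rabs (RS_sum F g s - (J (seq.last (SF_h s) (SF_lx s)) - J (SF_h s)))
                 <= w (seq.last (SF_h s) (SF_lx s)) - w (SF_h s)).
    { apply IH; try assumption.
      intros x xi y Hx Hxi Hy Hl; apply Hloc; lra. }
    apply Rabs_le_between in H1; apply Rabs_le_between in H2.
    apply Rabs_le_between; lra.
Qed.

Lemma Riemann_fine_intro (a b delta : R) (P : SF_seq -> Prop) :
  a <= b -> 0 < delta ->
  (forall s, pointed_subdiv s -> seq_step (SF_lx s) < delta ->
     SF_h s = a -> seq.last (SF_h s) (SF_lx s) = b -> P s) ->
  Riemann_fine a b P.
Proof.
  intros Hab Hd HP.
  exists (mkposreal delta Hd); simpl.
  intros s Hs [Hp [Ha Hb]].
  rewrite Rmin_left in Ha by assumption.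
  rewrite Rmax_right in Hb by assumption.
  now apply HP.
Qed.

(** Existence and value of a Stieltjes integral are thus reduced to an estimate
    on a single short interval, with error functions [w] of arbitrarily small
    total increment. *)
Lemma is_RSInt_of_local (F g J : R -> R) (a b : R) :
  a <= b ->
  (forall eps : R, 0 < eps -> exists (delta : R) (w : R -> R),
     0 < delta /\ w b - w a <= eps /\
     forall x xi y : R, a <= x -> x <= xi -> xi <= y -> y <= b -> y - x < delta ->
       Rabs ((g y - g x) * F xi - (J y - J x)) <= w y - w x) ->
  is_RSInt F g a b (J b - J a).
Proof.
  intros Hab H.
  apply filterlim_locally; intros eps.
  destruct (H (eps / 2)) as [delta [w [Hd [Hw Hloc]]]].
  { generalize (cond_pos eps); lra. }
  apply (Riemann_fine_intro a b delta); try assumption.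
  intros s Hp Hs Ha Hb.
  change (Rabs (RS_sum F g s - (J b - J a)) < eps).
  generalize (RS_sum_approx F g J w delta s Hp Hs).
  rewrite Hb, Ha; intros H1.
  generalize (cond_pos eps) (H1 Hloc); lra.
Qed.

(** The bound of a Stieltjes sum by the supremum of the integrand times the
    variation of the integrator, applied to [F - G]. *)
Lemma RS_sum_near (F G g v : R -> R) (a b e : R) (s : SF_seq) :
  increments_dominated g v a b ->
  (forall x, a <= x <= b -> Rabs (F x - G x) <= e) ->
  pointed_subdiv s -> SF_h s = a -> seq.last (SF_h s) (SF_lx s) = b ->
  Rabs (RS_sum F g s - RS_sum G g s) <= e * (v b - v a).
Proof.
  intros Hg He Hp Ha Hb.
  generalize (RS_sum_approx (fun x => F x - G x) g (fun _ => 0) (fun x => e * v x)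
    (seq_step (SF_lx s) + 1) s Hp).
  rewrite Hb, Ha, RS_sum_minus, !Rminus_0_r, <- Rmult_minus_distr_l.
  intros H; apply H; [lra|].
  intros x xi y Hx Hxi Hy Hyb _.
  rewrite !Rminus_0_r, Rabs_mult, <- Rmult_minus_distr_l, (Rmult_comm e).
  apply Rmult_le_compat; try apply Rabs_pos.
  - apply Hg; lra.
  - apply He; lra.
Qed.

Lemma is_RSInt_near (F G g v : R -> R) (a b e lF lG : R) :
  a <= b -> increments_dominated g v a b ->
  (forall x, a <= x <= b -> Rabs (F x - G x) <= e) ->
  is_RSInt F g a b lF -> is_RSInt G g a b lG ->
  Rabs (lF - lG) <= e * (v b - v a).
Proof.
  intros Hab Hg He HF HG.
  apply le_epsilon; intros eps Heps.
  assert (He2 : 0 < eps / 2) by lra.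
  assert (HF' := proj1 (filterlim_locally _ _) HF (mkposreal _ He2)).
  assert (HG' := proj1 (filterlim_locally _ _) HG (mkposreal _ He2)).
  assert (HN : Riemann_fine a b (fun s =>
    Rabs (RS_sum F g s - RS_sum G g s) <= e * (v b - v a))).
  { apply (Riemann_fine_intro a b 1); try lra.
    intros s Hp _ Ha Hb; now apply (RS_sum_near F G g v a b e s). }
  destruct (filter_ex _ (filter_and _ _ HN (filter_and _ _ HF' HG')))
    as [s [H0 [H1 H2]]].
  change (Rabs (RS_sum F g s - lF) < eps / 2) in H1.
  change (Rabs (RS_sum G g s - lG) < eps / 2) in H2.
  apply Rabs_def2 in H1; apply Rabs_def2 in H2; apply Rabs_le_between in H0.
  apply Rabs_le_between; lra.
Qed.

(** By [RS_sum_near] the sums for [F] and for [Phi n] are uniformly close, so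
    the sums for [F] are Cauchy along the filter of fine subdivisions. *)
Lemma is_RSInt_uniform_limit (F g v : R -> R) (Phi : nat -> R -> R) (I : nat -> R)
    (a b : R) :
  a <= b -> increments_dominated g v a b ->
  (forall n, is_RSInt (Phi n) g a b (I n)) ->
  (forall eps : R, 0 < eps -> exists N : nat, forall n : nat, (N <= n)%nat ->
     forall x, a <= x <= b -> Rabs (F x - Phi n x) <= eps) ->
  exists L, is_RSInt F g a b L /\ is_lim_seq I L.
Proof.
  intros Hab Hg HI Hunif.
  assert (HV : 0 <= v b - v a).
  { generalize (Hg a b (Rle_refl a) Hab (Rle_refl b)) (Rabs_pos (g b - g a)); lra. }
  assert (Hsmall : forall eps : posreal, exists e, 0 < e /\ e * (v b - v a) < eps).
  { intros eps; exists (eps / (v b - v a + 1)).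
    assert (0 < eps) by apply cond_pos.
    split; [apply Rdiv_lt_0_compat; lra|].
    apply (Rmult_lt_reg_r (v b - v a + 1)); [lra|].
    replace (eps / (v b - v a + 1) * (v b - v a) * (v b - v a + 1))
      with (eps * (v b - v a)) by (field; lra).
    apply Rmult_lt_compat_l; lra. }
  assert (Hex : exists L, is_RSInt F g a b L).
  { apply (filterlim_locally_cauchy (RS_sum F g)).
    intros eps.
    destruct (Hsmall (pos_div_2 (pos_div_2 eps))) as [e [He HeV]]; simpl in HeV.
    destruct (Hunif e He) as [N HN].
    assert (HIN := proj1 (filterlim_locally _ _) (HI N) (pos_div_2 (pos_div_2 eps))).
    exists (fun s => Rabs (RS_sum F g s - I N) < eps / 2); split.
    - assert (Hnear : Riemann_fine a b (fun s =>
        Rabs (RS_sum F g s - RS_sum (Phi N) g s) <= e * (v b - v a))).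
      { apply (Riemann_fine_intro a b 1); try lra.
        intros s Hp _ Ha Hb; apply (RS_sum_near F (Phi N) g v a b e s); auto. }
      refine (filter_imp _ _ _ (filter_and _ _ Hnear HIN)).
      intros s [H1 H2].
      change (Rabs (RS_sum (Phi N) g s - I N) < eps / 2 / 2) in H2.
      apply Rabs_le_between in H1; apply Rabs_def2 in H2.
      apply Rabs_def1; lra.
    - intros s t Hs Ht.
      change (Rabs (RS_sum F g t - RS_sum F g s) < eps).
      apply Rabs_def2 in Hs; apply Rabs_def2 in Ht.
      apply Rabs_def1; lra. }
  destruct Hex as [L HL]; exists L; split; [exact HL|].
  apply filterlim_locally; intros eps.
  destruct (Hsmall eps) as [e [He HeV]].
  destruct (Hunif e He) as [N HN].
  exists N; intros n Hn.
  change (Rabs (I n - L) < eps).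
  rewrite Rabs_minus_sym.
  apply Rle_lt_trans with (2 := HeV).
  apply (is_RSInt_near F (Phi n) g v a b); auto.
Qed.

(** * Riemann integrability of functions of bounded variation *)

Lemma is_RInt_Riemann_sum (f : R -> R) (a b l : R) :
  a < b ->
  is_RInt f a b l <-> filterlim (Riemann_sum f) (Riemann_fine a b) (locally l).
Proof.
  intros Hab; unfold is_RInt.
  split; apply filterlim_ext; intros s;
    rewrite sign_eq_1 by lra; [|symmetry]; exact (scal_one (Riemann_sum f s)).
Qed.

(** The Riemann sums of [f] stay within those of [psi] from those of [phi];
    both of the latter converge, so the sums of [f] are Cauchy up to twice the
    integral of [psi]. *)
Lemma ex_RInt_squeeze (f : R -> R) (a b : R) :
  a <= b ->
  (forall eps : R, 0 < eps -> exists phi psi : R -> R,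
     ex_RInt phi a b /\ ex_RInt psi a b /\
     (forall x, a <= x <= b -> Rabs (f x - phi x) <= psi x) /\
     RInt psi a b <= eps) ->
  ex_RInt f a b.
Proof.
  intros Hab H.
  destruct Hab as [Hab | Hab]; [|rewrite Hab; apply ex_RInt_point].
  assert (Hex : exists l : R, filterlim (Riemann_sum f) (Riemann_fine a b) (locally l)).
  { apply (filterlim_locally_cauchy (Riemann_sum f)).
    intros eps.
    assert (Heps := cond_pos eps).
    destruct (H (eps / 8)) as [phi [psi [[lphi Hphi] [Hpsi [Hle He]]]]]; [lra|].
    apply (RInt_correct psi), (is_RInt_Riemann_sum _ _ _ _ Hab) in Hpsi.
    apply (is_RInt_Riemann_sum _ _ _ _ Hab) in Hphi.
    assert (He8 : 0 < eps / 8) by lra.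
    assert (H1 := proj1 (filterlim_locally _ _) Hphi (mkposreal _ He8)).
    assert (H2 := proj1 (filterlim_locally _ _) Hpsi (mkposreal _ He8)).
    exists (fun s => Rabs (Riemann_sum f s - lphi) < eps / 2); split.
    - assert (H3 : Riemann_fine a b (fun s =>
        Rabs (Riemann_sum f s - Riemann_sum phi s) <= Riemann_sum psi s)).
      { apply (Riemann_fine_intro a b 1); try lra.
        intros s Hp _ Ha Hb.
        rewrite <- (Riemann_sum_minus f phi s : _ = _ - _).
        apply (Riemann_sum_norm (fun x => minus (f x) (phi x)) psi s Hp).
        intros t Ht; apply Hle; rewrite <- Ha, <- Hb; exact Ht. }
      refine (filter_imp _ _ _ (filter_and _ _ H3 (filter_and _ _ H1 H2))).
      intros s [G3 [G1 G2]].
      change (Rabs (Riemann_sum phi s - lphi) < eps / 8) in G1.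
      change (Rabs (Riemann_sum psi s - RInt psi a b) < eps / 8) in G2.
      apply Rabs_le_between in G3; apply Rabs_def2 in G1; apply Rabs_def2 in G2.
      apply Rabs_def1; lra.
    - intros s t Hs Ht.
      change (Rabs (Riemann_sum f t - Riemann_sum f s) < eps).
      apply Rabs_def2 in Hs; apply Rabs_def2 in Ht.
      apply Rabs_def1; lra. }
  destruct Hex as [l Hl]; exists l.
  now apply is_RInt_Riemann_sum.
Qed.

(** Freezing [g] at the left end of each of [n] pieces of length [h] costs at
    most the increment of [v] over the piece.  The integral of the resulting error
    [psi] is [h] times the telescoping sum of these increments.  With
    no piece the interval is the single point [a], so the induction can start from
    [phi = g]. *)
Lemma step_squeeze (g v : R -> R) (a h : R) (n : nat) :
  0 <= h ->
  increments_dominated g v a (a + INR n * h) ->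
  exists phi psi : R -> R,
    ex_RInt phi a (a + INR n * h) /\
    is_RInt psi a (a + INR n * h) (h * (v (a + INR n * h) - v a)) /\
    forall x, a <= x <= a + INR n * h -> Rabs (g x - phi x) <= psi x.
Proof.
  intros Hh; induction n as [|n IH]; intros Hg.
  - exists g, (fun _ => 0); simpl INR.
    rewrite Rmult_0_l, Rplus_0_r.
    split; [apply ex_RInt_point|]; split.
    + replace (h * (v a - v a)) with 0 by ring.
      exact (is_RInt_point (fun _ => 0) a).
    + intros x _; rewrite Rminus_eq_0, Rabs_R0; apply Rle_refl.
  - set (c := a + INR n * h) in *.
    replace (a + INR (S n) * h) with (c + h) in * by (rewrite S_INR; unfold c; ring).
    assert (Hac : a <= c).
    { unfold c; generalize (Rmult_le_pos _ _ (pos_INR n) Hh); lra. }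
    destruct IH as [phi [psi [Hphi [Hpsi Hle]]]].
    { intros x y Hx Hxy Hy; apply Hg; lra. }
    exists (fun x => if Rle_dec x c then phi x else g c),
           (fun x => if Rle_dec x c then psi x else v (c + h) - v c).
    split; [|split].
    + apply (ex_RInt_Chasles _ a c).
      * apply (ex_RInt_ext phi); [|exact Hphi].
        rewrite Rmin_left, Rmax_right by lra; intros x Hx.
        destruct (Rle_dec x c); [reflexivity|lra].
      * apply (ex_RInt_ext (fun _ => g c)); [|apply ex_RInt_const].
        rewrite Rmin_left, Rmax_right by lra; intros x Hx.
        destruct (Rle_dec x c); [lra|reflexivity].
    + replace (h * (v (c + h) - v a))
        with (plus (h * (v c - v a)) (h * (v (c + h) - v c)))
        by (unfold plus; simpl; ring).
      apply (is_RInt_Chasles (V := R_NormedModule) _ a c (c + h)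
        (h * (v c - v a)) (h * (v (c + h) - v c))).
      * apply (is_RInt_ext psi); [|exact Hpsi].
        rewrite Rmin_left, Rmax_right by lra; intros x Hx.
        destruct (Rle_dec x c); [reflexivity|lra].
      * apply (is_RInt_ext (fun _ => v (c + h) - v c)).
        -- rewrite Rmin_left, Rmax_right by lra; intros x Hx.
           destruct (Rle_dec x c); [lra|reflexivity].
        -- generalize (is_RInt_const c (c + h) (v (c + h) - v c)).
           now replace (c + h - c) with h by ring.
    + intros x Hx; destruct (Rle_dec x c) as [Hxc|Hxc]; [apply Hle; lra|].
      apply Rle_trans with (v x - v c); [apply Hg; lra|].
      generalize (Hg x (c + h)) (Rabs_pos (g (c + h) - g x)); intros H1 H2.
      assert (H3 : Rabs (g (c + h) - g x) <= v (c + h) - v x) by (apply H1; lra).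
      lra.
Qed.

(** The error of [step_squeeze] is inversely proportional to the number of
    pieces, whatever the discontinuities of [g]. *)
Lemma ex_RInt_dominated (g v : R -> R) (a b : R) :
  a <= b -> increments_dominated g v a b -> ex_RInt g a b.
Proof.
  intros Hab Hg.
  assert (HV : 0 <= v b - v a).
  { generalize (Hg a b (Rle_refl a) Hab (Rle_refl b)) (Rabs_pos (g b - g a)); lra. }
  apply ex_RInt_squeeze; [exact Hab|]; intros eps Heps.
  (* [h * (v b - v a) <= eps] as soon as the number of pieces exceeds this ratio *)
  destruct (INR_unbounded ((b - a) * (v b - v a) / eps)) as [n Hn].
  assert (Hn0 : 0 < INR (S n)) by (apply lt_0_INR; lia).
  set (h := (b - a) / INR (S n)).
  assert (Hh : 0 <= h) by (apply Rdiv_le_0_compat; lra).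
  assert (Hb : a + INR (S n) * h = b) by (unfold h; field; lra).
  destruct (step_squeeze g v a h (S n) Hh) as [phi [psi H]]; rewrite Hb in *; [exact Hg|].
  destruct H as [Hphi [Hpsi Hle]].
  exists phi, psi; repeat split; try assumption.
  - eexists; exact Hpsi.
  - rewrite (is_RInt_unique _ _ _ _ Hpsi).
    apply (Rmult_le_reg_r (INR (S n))); [exact Hn0|].
    replace (h * (v b - v a) * INR (S n)) with ((b - a) * (v b - v a))
      by (unfold h; field; lra).
    apply (Rmult_le_reg_r (/ eps)); [now apply Rinv_0_lt_compat|].
    replace (eps * INR (S n) * / eps) with (INR (S n)) by (field; lra).
    rewrite S_INR; unfold Rdiv in Hn; lra.
Qed.

Lemma increments_dominated_bounded (g v : R -> R) (a b : R) :
  increments_dominated g v a b ->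
  forall x, a <= x <= b -> Rabs (g x) <= Rabs (g a) + (v b - v a).
Proof.
  intros Hg x Hx.
  assert (H1 : Rabs (g x - g a) <= v x - v a) by (apply Hg; lra).
  assert (H2 : Rabs (g b - g x) <= v b - v x) by (apply Hg; lra).
  generalize (Rabs_triang (g x - g a) (g a)) (Rabs_pos (g b - g x)).
  replace (g x - g a + g a) with (g x) by ring; lra.
Qed.

(** A product of a function of bounded variation with a bounded Lipschitz
    function has bounded variation; this is what makes [g] times a cosine or a
    sine Riemann integrable. *)
Lemma increments_dominated_mult (g v h : R -> R) (a b B L : R) :
  0 <= L -> increments_dominated g v a b ->
  (forall x, Rabs (h x) <= B) ->
  (forall x y, x <= y -> Rabs (h y - h x) <= L * (y - x)) ->
  increments_dominated (fun x => g x * h x)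
    (fun x => B * v x + (Rabs (g a) + (v b - v a)) * L * x) a b.
Proof.
  intros HL Hg HB HLip x y Hx Hxy Hy.
  replace (g y * h y - g x * h x)
    with (h x * (g y - g x) + g y * (h y - h x)) by ring.
  eapply Rle_trans; [apply Rabs_triang|].
  rewrite !Rabs_mult.
  assert (H1 : Rabs (h x) * Rabs (g y - g x) <= B * (v y - v x)).
  { apply Rmult_le_compat; try apply Rabs_pos; [apply HB | apply Hg; lra]. }
  assert (H2 : Rabs (g y) * Rabs (h y - h x)
    <= (Rabs (g a) + (v b - v a)) * (L * (y - x))).
  { apply Rmult_le_compat; try apply Rabs_pos.
    - apply (increments_dominated_bounded g v a b Hg); lra.
    - now apply HLip. }
  lra.
Qed.

(** * Stieltjes integrals with a smooth integrand or a smooth integrator *)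

(** The expected value on [[a, x]] is [J x - J a], where [J] is [Phi * g] minus
    the primitive of [g * phi].  On a piece [[x, y]] with tag
    [xi], the error [(g y - g x) * Phi xi - (J y - J x)] equals
    [RInt ((g - g x) * phi) x xi + RInt ((g - g y) * phi) xi y], which is at most
    [(y - x) * M * (v y - v x)] where [M] bounds [phi].  Telescoping leaves the mesh
    times [M * (v b - v a)]. *)
Lemma is_RSInt_by_parts (g v Phi phi : R -> R) (a b : R) :
  a <= b -> increments_dominated g v a b ->
  (forall x, is_derive Phi x (phi x)) -> (forall x, continuous phi x) ->
  ex_RInt (fun x => g x * phi x) a b ->
  is_RSInt Phi g a b
    (Phi b * g b - Phi a * g a - RInt (fun x => g x * phi x) a b).
Proof.
  intros Hab Hg HPhi Hphi Hint.
  destruct (continuity_ab_maj (fun x => Rabs (phi x)) a b Hab) as [m [Hm _]].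
  { intros x _; apply continuity_pt_filterlim.
    apply (continuous_comp phi Rabs); [apply Hphi | apply continuous_Rabs]. }
  set (M := Rabs (phi m)) in *.
  assert (HV : 0 <= v b - v a).
  { generalize (Hg a b (Rle_refl a) Hab (Rle_refl b)) (Rabs_pos (g b - g a)); lra. }
  assert (HM : 0 <= M) by apply Rabs_pos.
  set (J := fun x => Phi x * g x - RInt (fun t => g t * phi t) a x).
  replace (Phi b * g b - Phi a * g a - RInt (fun x => g x * phi x) a b)
    with (J b - J a)
    by (unfold J; rewrite (RInt_point a); unfold zero; simpl; ring).
  assert (Hsub : forall x y, a <= x -> x <= y -> y <= b -> ex_RInt (fun t => g t * phi t) x y).
  { intros x y Hx Hxy Hy.
    apply (ex_RInt_Chasles_2 (V := R_CompleteNormedModule) _ a); [lra|].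
    apply (ex_RInt_Chasles_1 (V := R_CompleteNormedModule) _ a y b); [lra|exact Hint]. }
  (* [g] is compared with its value at [p] left of the tag, at [q] right of it *)
  assert (Hpiece : forall p q r, a <= p -> p <= q -> q <= b -> (r = p \/ r = q) ->
    Rabs (g r * (Phi q - Phi p) - RInt (fun t => g t * phi t) p q)
      <= (q - p) * (M * (v q - v p))).
  { intros p q r Hp Hpq Hq Hr.
    assert (Hd : is_RInt phi p q (Phi q - Phi p)).
    { apply (is_RInt_derive (V := R_CompleteNormedModule) Phi phi); intros; [apply HPhi | apply Hphi]. }
    assert (Hi := RInt_correct _ _ _ (Hsub p q Hp Hpq Hq)).
    apply (norm_RInt_le_const (V := R_NormedModule) (fun t => minus (scal (g r) (phi t)) (g t * phi t)) p q
      (minus (scal (g r) (Phi q - Phi p)) (RInt (fun t => g t * phi t) p q))); [exact Hpq| |].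
    - intros t Ht.
      change (Rabs (g r * phi t - g t * phi t) <= M * (v q - v p)).
      replace (g r * phi t - g t * phi t) with (phi t * (g r - g t)) by ring.
      rewrite Rabs_mult.
      assert (H1 : Rabs (g t - g p) <= v t - v p) by (apply Hg; lra).
      assert (H2 : Rabs (g q - g t) <= v q - v t) by (apply Hg; lra).
      generalize (Rabs_pos (g t - g p)) (Rabs_pos (g q - g t)); intros H3 H4.
      apply Rmult_le_compat; try apply Rabs_pos.
      + apply Hm; lra.
      + destruct Hr; subst r; [rewrite Rabs_minus_sym|]; lra.
    - apply (is_RInt_minus (V := R_NormedModule) _ _ p q); [|exact Hi].
      apply (is_RInt_scal (V := R_NormedModule) phi p q (g r)); exact Hd. }
  apply is_RSInt_of_local; [exact Hab|]; intros eps Heps.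
  set (delta := eps / (M * (v b - v a) + 1)).
  assert (HMV : 0 <= M * (v b - v a)) by now apply Rmult_le_pos.
  exists delta, (fun x => delta * M * v x).
  assert (Hdelta : 0 < delta) by (apply Rdiv_lt_0_compat; lra).
  split; [exact Hdelta|]; split.
  - apply Rle_trans with (delta * (M * (v b - v a) + 1)); [lra|].
    right; unfold delta; field; lra.
  - intros x xi y Hx Hxi Hy Hyb Hxy.
    unfold J.
    assert (HC : RInt (fun t => g t * phi t) a y = RInt (fun t => g t * phi t) a x
      + (RInt (fun t => g t * phi t) x xi + RInt (fun t => g t * phi t) xi y)).
    { rewrite <- (RInt_Chasles (fun t => g t * phi t) a x y); [|apply Hsub; lra..].
      rewrite <- (RInt_Chasles (fun t => g t * phi t) x xi y); [|apply Hsub; lra..].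
      reflexivity. }
    rewrite HC.
    assert (H1 := Hpiece x xi x Hx Hxi (Rle_trans _ _ _ Hy Hyb) (or_introl eq_refl)).
    assert (H2 := Hpiece xi y y (Rle_trans _ _ _ Hx Hxi) Hy Hyb (or_intror eq_refl)).
    assert (Hmono : forall p q, a <= p -> p <= q -> q <= b -> 0 <= v q - v p).
    { intros p q Hp Hpq Hq; generalize (Hg p q Hp Hpq Hq) (Rabs_pos (g q - g p)); lra. }
    assert (H3 : (xi - x) * (M * (v xi - v x)) <= delta * (M * (v xi - v x))).
    { apply Rmult_le_compat_r; [apply Rmult_le_pos; [lra|apply Hmono; lra]|lra]. }
    assert (H4 : (y - xi) * (M * (v y - v xi)) <= delta * (M * (v y - v xi))).
    { apply Rmult_le_compat_r; [apply Rmult_le_pos; [lra|apply Hmono; lra]|lra]. }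
    apply Rabs_le_between in H1; apply Rabs_le_between in H2.
    apply Rabs_le_between; split; lra.
Qed.

(** On a short piece the error is the integral of [(F xi - F) * gamma], which
    uniform continuity of [F] makes small compared with the length of the piece. *)
Lemma is_RSInt_C1 (F G gamma : R -> R) (a b : R) :
  a <= b -> (forall x, continuous F x) ->
  (forall x, is_derive G x (gamma x)) -> (forall x, continuous gamma x) ->
  is_RSInt F G a b (RInt (fun x => F x * gamma x) a b).
Proof.
  intros Hab HF HG Hgamma.
  destruct (continuity_ab_maj (fun x => Rabs (gamma x)) a b Hab) as [m [Hm _]].
  { intros x _; apply continuity_pt_filterlim.
    apply (continuous_comp gamma Rabs); [apply Hgamma | apply continuous_Rabs]. }
  set (M := Rabs (gamma m)) in *.
  assert (HM : 0 <= M) by apply Rabs_pos.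
  assert (Hex : forall x y, ex_RInt (fun t => F t * gamma t) x y).
  { intros x y; apply (ex_RInt_continuous (fun t => F t * gamma t)); intros z _.
    now apply (continuous_mult F gamma). }
  pose (J := (fun x => RInt (fun t => F t * gamma t) a x) : R -> R).
  replace (RInt (fun x => F x * gamma x) a b) with (J b - J a)
    by (unfold J; rewrite (RInt_point a); unfold zero; simpl; ring).
  apply is_RSInt_of_local; [exact Hab|]; intros eps Heps.
  assert (Hc : 0 < M * (b - a) + 1).
  { generalize (Rmult_le_pos M (b - a) HM); lra. }
  set (e := eps / (M * (b - a) + 1)).
  assert (He : 0 < e) by now apply Rdiv_lt_0_compat.
  destruct (Heine_cor2 (f := F) (a := a) (b := b)
    (fun x _ => proj2 (continuity_pt_filterlim F x) (HF x)) (mkposreal e He))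
    as [delta Hdelta]; simpl in Hdelta.
  exists delta, (fun x => e * M * x).
  split; [apply cond_pos|]; split.
  - apply Rle_trans with (e * (M * (b - a) + 1)); [lra|].
    right; unfold e; field; lra.
  - intros x xi y Hx Hxi Hy Hyb Hxy.
    unfold J.
    rewrite <- (RInt_Chasles (fun t => F t * gamma t) a x y) by apply Hex.
    replace ((G y - G x) * F xi - (plus (RInt (fun t => F t * gamma t) a x)
      (RInt (fun t => F t * gamma t) x y) - RInt (fun t => F t * gamma t) a x))
      with ((G y - G x) * F xi - RInt (fun t => F t * gamma t) x y)
      by (unfold plus; simpl; ring).
    rewrite <- Rmult_minus_distr_l, (Rmult_comm _ (y - x)).
    assert (Hd : is_RInt gamma x y (G y - G x)).
    { apply (is_RInt_derive (V := R_CompleteNormedModule) G gamma); intros; [apply HG | apply Hgamma]. }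
    assert (Hi := RInt_correct _ _ _ (Hex x y)).
    apply (norm_RInt_le_const (V := R_NormedModule) (fun t => minus (scal (F xi) (gamma t)) (F t * gamma t)) x y
      (minus ((G y - G x) * F xi) (RInt (fun t => F t * gamma t) x y))); [lra| |].
    + intros t Ht.
      change (Rabs (F xi * gamma t - F t * gamma t) <= e * M).
      rewrite <- Rmult_minus_distr_r, Rabs_mult.
      apply Rmult_le_compat; try apply Rabs_pos; [|apply Hm; lra].
      left; apply Hdelta; try lra.
      apply Rabs_def1; lra.
    + apply (is_RInt_minus (V := R_NormedModule) _ _ x y); [|exact Hi].
      rewrite Rmult_comm.
      apply (is_RInt_scal (V := R_NormedModule) gamma x y (F xi)); exact Hd.
Qed.

Lemma RSInt_unique (F g : R -> R) (a b l : R) : is_RSInt F g a b l -> RSInt F g a b = l.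
Proof.
  intros H.
  exact (iota_filterlim_locally (V := R_CompleteNormedModule) (RS_sum F g) l H).
Qed.

(** * A majorant for the increments of a function of bounded variation *)

(** The majorant is the variation over families of intervals lying left of [x]:
    adding the interval [(x, y)] to such a family gives one lying left of [y].
    The value [0] is put into the set to account for the empty family, which
    families indexed by [i <= n] cannot represent. *)
Lemma BV_increments_dominated (g : R -> R) :
  BV g -> exists v : R -> R, increments_dominated g v (- PI) PI.
Proof.
  intros [_ Hfin].
  pose (E := fun x z : R => z = 0 \/ exists (n : nat) (s t : nat -> R),
    disjoint_intervals n s t /\ (forall i, (i <= n)%nat -> t i <= x) /\
    z = sum_n (fun i => Rabs (g (s i) - g (t i))) n).
  set (V := Rmax 0 (real (variation g))).
  assert (HE : forall x, is_lub_Rbar (E x) (real (Lub_Rbar (E x)))).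
  { intros x.
    destruct (Lub_Rbar_correct (E x)) as [H1 H2].
    assert (H0 : Rbar_le 0 (Lub_Rbar (E x))) by (apply H1; left; reflexivity).
    assert (HV : Rbar_le (Lub_Rbar (E x)) V).
    { apply H2; intros z [Hz | [n [s [t [Hd [_ Hz]]]]]]; simpl.
      - rewrite Hz; apply Rmax_l.
      - apply Rle_trans with (2 := Rmax_r _ _).
        change (Rbar_le z (real (variation g))).
        rewrite Hfin.
        apply (proj1 (Lub_Rbar_correct _)).
        exists n, s, t; split; assumption. }
    assert (Hreal : Finite (real (Lub_Rbar (E x))) = Lub_Rbar (E x)).
    { destruct (Lub_Rbar (E x)); simpl in H0, HV; tauto. }
    rewrite Hreal; split; assumption. }
  exists (fun x => real (Lub_Rbar (E x))).
  intros x y Hx Hxy Hy.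
  destruct (HE x) as [_ Hx2]; destruct (HE y) as [Hy1 _].
  destruct Hxy as [Hxy | Hxy].
  2: { rewrite Hxy, !Rminus_eq_0, Rabs_R0; apply Rle_refl. }
  assert (Hstep : forall z, E x z -> z + Rabs (g y - g x) <= real (Lub_Rbar (E y))).
  { intros z Hz; apply (Hy1 (z + Rabs (g y - g x))); right.
    destruct Hz as [Hz | [n [s [t [[Hd1 Hd2] [Ht Hz]]]]]].
    - exists 0%nat, (fun _ => x), (fun _ => y).
      split; [split|split].
      + intros i _; split; [exact Hxy|intros; lra].
      + intros i j Hi Hj Hij; lia.
      + intros i _; apply Rle_refl.
      + rewrite sum_O, Hz, Rabs_minus_sym; ring.
    - exists (S n), (fun i => if le_dec i n then s i else x),
                    (fun i => if le_dec i n then t i else y).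
      split; [split|split].
      + intros i Hi; destruct (le_dec i n) as [Hin|Hin]; [now apply Hd1|].
        split; [lra|intros; lra].
      + intros i j Hi Hj Hij u.
        destruct (le_dec i n) as [Hin|Hin]; destruct (le_dec j n) as [Hjn|Hjn].
        * now apply Hd2.
        * generalize (Ht i Hin); lra.
        * generalize (Ht j Hjn); lra.
        * lia.
      + intros i Hi; destruct (le_dec i n) as [Hin|Hin]; [|lra].
        generalize (Ht i Hin); lra.
      + rewrite sum_Sn.
        destruct (le_dec (S n) n) as [H|_]; [lia|].
        rewrite (Rabs_minus_sym (g x)), Hz.
        change (plus ?p ?q) with (p + q).
        f_equal; apply sum_n_ext_loc; intros i Hi.
        now destruct (le_dec i n). }
  assert (H : Rbar_le (real (Lub_Rbar (E x)))
                (real (Lub_Rbar (E y)) - Rabs (g y - g x))).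
  { apply Hx2; intros z Hz; generalize (Hstep z Hz); simpl; lra. }
  simpl in H; lra.
Qed.

(** * Fejér means *)

Definition cos_coef (u : R -> R) (x : R) : R :=
  RInt (fun s => u s * cos (x * s)) (- PI) PI.

Definition sin_coef (u : R -> R) (x : R) : R :=
  RInt (fun s => u s * sin (x * s)) (- PI) PI.

(** The number of integers of absolute value [k]: it turns a sum over [Z] of an
    even summand into a sum over [nat]. *)
Definition fold_weight (k : nat) : R := match k with O => 1 | S _ => 2 end.

Definition fejer_coef (n k : nat) : R := fold_weight k * (1 - INR k / (INR n + 1)).

Definition fejer_kernel (n : nat) (x : R) : R :=
  sum_n (fun k => fejer_coef n k * cos (INR k * x)) n.

Definition fejer_mean (u : R -> R) (n : nat) (t : R) : R :=
  / (2 * PI) * sum_n (fun k => fejer_coef n k *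
    (cos_coef u (INR k) * cos (INR k * t) + sin_coef u (INR k) * sin (INR k * t))) n.

(** The Dirichlet kernel telescopes after multiplication by [1 - cos x], since
    [2 * cos (n * x) * cos x] is [cos ((n + 1) * x) + cos ((n - 1) * x)]. *)
Lemma dirichlet_kernel_mult (n : nat) (x : R) :
  sum_n (fun k => fold_weight k * cos (INR k * x)) n * (1 - cos x)
  = cos (INR n * x) - cos ((INR n + 1) * x).
Proof.
  induction n as [|n IH].
  - rewrite sum_O; simpl; rewrite Rmult_0_l, cos_0, Rplus_0_l, !Rmult_1_l; ring.
  - rewrite sum_Sn; change (plus ?p ?q) with (p + q).
    rewrite Rmult_plus_distr_r, IH, S_INR; cbn [fold_weight].
    replace ((INR n + 1 + 1) * x) with ((INR n + 1) * x + x) by ring.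
    replace (INR n * x) with ((INR n + 1) * x - x) by ring.
    rewrite cos_minus, cos_plus; ring.
Qed.

(** [INR n + 1] times the Fejér kernel is the sum of the first [n + 1] Dirichlet
    kernels, so the previous identity telescopes a second time. *)
Lemma fejer_kernel_mult (n : nat) (x : R) :
  fejer_kernel n x * (1 - cos x) = (1 - cos ((INR n + 1) * x)) / (INR n + 1).
Proof.
  assert (H : forall n, sum_n (fun k => fold_weight k * (INR n + 1 - INR k) * cos (INR k * x)) n
    * (1 - cos x) = 1 - cos ((INR n + 1) * x)).
  { clear n; induction n as [|n IH].
    - rewrite sum_O; simpl; rewrite Rmult_0_l, cos_0, Rplus_0_l, !Rmult_1_l; ring.
    - rewrite (sum_n_ext _ (fun k => plus (fold_weight k * (INR n + 1 - INR k) * cos (INR k * x))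
        (fold_weight k * cos (INR k * x)))).
      2: { intros k; rewrite S_INR; unfold plus; simpl; ring. }
      rewrite sum_n_plus, (sum_Sn (fun k => _ * (INR n + 1 - INR k) * _)).
      change (plus ?p ?q) with (p + q).
      rewrite !Rmult_plus_distr_r, IH, dirichlet_kernel_mult, S_INR.
      replace ((INR n + 1 + 1) * x) with ((INR n + 1) * x + 1 * x) by ring.
      ring. }
  assert (Hn : INR n + 1 <> 0) by (generalize (pos_INR n); lra).
  assert (HK : fejer_kernel n x = / (INR n + 1) *
    sum_n (fun k => fold_weight k * (INR n + 1 - INR k) * cos (INR k * x)) n).
  { unfold fejer_kernel; rewrite <- (sum_n_mult_l (K := R_Ring)).
    apply sum_n_ext; intros k; unfold fejer_coef, mult; simpl; field; exact Hn. }
  rewrite HK, Rmult_assoc, H; field; exact Hn.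
Qed.

Lemma fejer_coef_pos (n k : nat) : (k <= n)%nat -> 0 <= fejer_coef n k.
Proof.
  intros Hk; apply le_INR in Hk; assert (H := pos_INR k).
  apply Rmult_le_pos; [destruct k; simpl; lra|].
  replace (1 - INR k / (INR n + 1)) with ((INR n + 1 - INR k) / (INR n + 1))
    by (field; lra).
  apply Rdiv_le_0_compat; lra.
Qed.

Lemma sum_n_nonneg (a : nat -> R) (n : nat) :
  (forall k, (k <= n)%nat -> 0 <= a k) -> 0 <= sum_n a n.
Proof.
  induction n as [|n IH]; intros Ha.
  - rewrite sum_O; now apply Ha.
  - rewrite sum_Sn; apply Rplus_le_le_0_compat; [apply IH; intros k Hk|]; apply Ha; lia.
Qed.

(** Where [cos x < 1] this is read off [fejer_kernel_mult]; where [cos x = 1]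
    every cosine in the kernel is [1] and the coefficients are nonnegative. *)
Lemma fejer_kernel_pos (n : nat) (x : R) : 0 <= fejer_kernel n x.
Proof.
  assert (Hn : 0 < INR n + 1) by (generalize (pos_INR n); lra).
  destruct (COS_bound x) as [_ [Hx | Hx]].
  - apply (Rmult_le_reg_r (1 - cos x)); [lra|].
    rewrite Rmult_0_l, fejer_kernel_mult.
    apply Rdiv_le_0_compat; [|exact Hn].
    generalize (COS_bound ((INR n + 1) * x)); lra.
  - assert (Hcos : forall k, cos (INR k * x) = 1).
    { assert (Hs : sin x = 0) by (generalize (sin2_cos2 x); unfold Rsqr; rewrite Hx; nra).
      induction k as [|k IH].
      - simpl; rewrite Rmult_0_l; apply cos_0.
      - rewrite S_INR, Rmult_plus_distr_r, Rmult_1_l, cos_plus, IH, Hx, Hs; ring. }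
    apply sum_n_nonneg; intros k Hk.
    rewrite Hcos, Rmult_1_r; now apply fejer_coef_pos.
Qed.

Lemma is_RInt_sum_n (f : nat -> R -> R) (l : nat -> R) (a b : R) (n : nat) :
  (forall k, is_RInt (f k) a b (l k)) ->
  is_RInt (fun x => sum_n (fun k => f k x) n) a b (sum_n l n).
Proof.
  intros H; induction n as [|n IH].
  - rewrite sum_O; apply (is_RInt_ext (f 0%nat)); [|apply H].
    intros x _; now rewrite sum_O.
  - rewrite sum_Sn.
    apply (is_RInt_ext (fun x => plus (sum_n (fun k => f k x) n) (f (S n) x))).
    + intros x _; now rewrite sum_Sn.
    + apply (is_RInt_plus (V := R_NormedModule)); [exact IH|apply H].
Qed.

Lemma continuous_cos_mult (x s : R) : continuous (fun s => cos (x * s)) s.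
Proof.
  apply (ex_derive_continuous (fun s => cos (x * s))); auto_derive; exact I.
Qed.

Lemma continuous_sin_mult (x s : R) : continuous (fun s => sin (x * s)) s.
Proof.
  apply (ex_derive_continuous (fun s => sin (x * s))); auto_derive; exact I.
Qed.

Lemma is_RInt_cos_coef (u : R -> R) (x : R) :
  (forall s, continuous u s) ->
  is_RInt (fun s => u s * cos (x * s)) (- PI) PI (cos_coef u x).
Proof.
  intros Hu; apply (RInt_correct (V := R_CompleteNormedModule)).
  apply (ex_RInt_continuous (V := R_CompleteNormedModule)); intros s _.
  apply (continuous_mult u); [apply Hu | apply continuous_cos_mult].
Qed.

Lemma is_RInt_sin_coef (u : R -> R) (x : R) :
  (forall s, continuous u s) ->
  is_RInt (fun s => u s * sin (x * s)) (- PI) PI (sin_coef u x).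
Proof.
  intros Hu; apply (RInt_correct (V := R_CompleteNormedModule)).
  apply (ex_RInt_continuous (V := R_CompleteNormedModule)); intros s _.
  apply (continuous_mult u); [apply Hu | apply continuous_sin_mult].
Qed.

(** The addition formula for [cos (INR k * (t - s))] exhibits the Fejér mean as a
    convolution with the Fejér kernel, normalized by [2 * PI]. *)
Lemma is_RInt_fejer_mean (u : R -> R) (n : nat) (t : R) :
  (forall s, continuous u s) ->
  is_RInt (fun s => fejer_kernel n (t - s) * u s) (- PI) PI
    (2 * PI * fejer_mean u n t).
Proof.
  intros Hu; assert (Hpi := PI_RGT_0).
  assert (Hmean : 2 * PI * fejer_mean u n t = sum_n (fun k => fejer_coef n k *
    (cos_coef u (INR k) * cos (INR k * t) + sin_coef u (INR k) * sin (INR k * t))) n)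
    by (unfold fejer_mean; field; lra).
  rewrite Hmean.
  apply (is_RInt_ext (fun s => sum_n (fun k => fejer_coef n k *
    (u s * cos (INR k * s) * cos (INR k * t)
     + u s * sin (INR k * s) * sin (INR k * t))) n)).
  - intros s _; unfold fejer_kernel.
    change (sum_n (fun k => fejer_coef n k * cos (INR k * (t - s))) n * u s)
      with (mult (sum_n (fun k => fejer_coef n k * cos (INR k * (t - s))) n) (u s)).
    rewrite <- (sum_n_mult_r (u s)); apply sum_n_ext; intros k.
    replace (INR k * (t - s)) with (INR k * t - INR k * s) by ring.
    rewrite cos_minus; unfold mult; simpl; ring.
  - apply is_RInt_sum_n; intros k.
    apply (is_RInt_scal (V := R_NormedModule) _ _ _ (fejer_coef n k)).
    apply (is_RInt_plus (V := R_NormedModule)).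
    + apply (is_RInt_ext (fun s => scal (cos (INR k * t)) (u s * cos (INR k * s)))).
      { intros s _; apply Rmult_comm. }
      rewrite (Rmult_comm (cos_coef u (INR k))).
      apply (is_RInt_scal (V := R_NormedModule)); now apply is_RInt_cos_coef.
    + apply (is_RInt_ext (fun s => scal (sin (INR k * t)) (u s * sin (INR k * s)))).
      { intros s _; apply Rmult_comm. }
      rewrite (Rmult_comm (sin_coef u (INR k))).
      apply (is_RInt_scal (V := R_NormedModule)); now apply is_RInt_sin_coef.
Qed.

Lemma sin_INR_PI (k : nat) : sin (INR k * PI) = 0.
Proof.
  induction k as [|k IH].
  - simpl; rewrite Rmult_0_l; apply sin_0.
  - rewrite S_INR, Rmult_plus_distr_r, Rmult_1_l, neg_sin, IH; ring.
Qed.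

Lemma cos_coef_one (x : R) : x <> 0 -> cos_coef (fun _ => 1) x = 2 * sin (x * PI) / x.
Proof.
  intros Hx; apply is_RInt_unique.
  assert (E : 2 * sin (x * PI) / x = sin (x * PI) / x - sin (x * - PI) / x).
  { rewrite <- Ropp_mult_distr_r, sin_neg; field; exact Hx. }
  rewrite E.
  apply (is_RInt_derive (V := R_CompleteNormedModule) (fun s => sin (x * s) / x)).
  - intros s _; auto_derive; [exact I|field; exact Hx].
  - intros s _; apply (continuous_mult (fun _ => 1)).
    + apply continuous_const.
    + apply continuous_cos_mult.
Qed.

Lemma sin_coef_one (x : R) : x <> 0 -> sin_coef (fun _ => 1) x = 0.
Proof.
  intros Hx; apply is_RInt_unique.
  assert (E : 0 = - cos (x * PI) / x - - cos (x * - PI) / x).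
  { rewrite <- Ropp_mult_distr_r, cos_neg; field; exact Hx. }
  rewrite E.
  apply (is_RInt_derive (V := R_CompleteNormedModule) (fun s => - cos (x * s) / x)).
  - intros s _; auto_derive; [exact I|field; exact Hx].
  - intros s _; apply (continuous_mult (fun _ => 1)).
    + apply continuous_const.
    + apply continuous_sin_mult.
Qed.

(** Through [is_RInt_fejer_mean] this says that the Fejér kernel has mean value
    [1]. *)
Lemma fejer_mean_one (n : nat) (t : R) : fejer_mean (fun _ => 1) n t = 1.
Proof.
  assert (Hpi := PI_RGT_0).
  assert (H0 : cos_coef (fun _ => 1) (INR 0) = 2 * PI).
  { apply is_RInt_unique.
    apply (is_RInt_ext (fun _ => 1)).
    - intros s _; simpl; rewrite Rmult_0_l, cos_0; ring.
    - replace (2 * PI) with (scal (PI - - PI) 1) by (unfold scal; simpl; unfold mult; simpl; ring).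
      apply (is_RInt_const (V := R_NormedModule)). }
  assert (Hs0 : sin_coef (fun _ => 1) (INR 0) = 0).
  { apply is_RInt_unique.
    apply (is_RInt_ext (fun _ => 0)).
    - intros s _; simpl; rewrite Rmult_0_l, sin_0; ring.
    - generalize (is_RInt_const (V := R_NormedModule) (- PI) PI 0).
      change (scal (PI - - PI) 0) with ((PI - - PI) * 0).
      now rewrite Rmult_0_r. }
  assert (Hk : forall k, cos_coef (fun _ => 1) (INR (S k)) = 0).
  { intros k; rewrite cos_coef_one by (apply not_0_INR; lia).
    rewrite sin_INR_PI; unfold Rdiv; ring. }
  assert (Hsk : forall k, sin_coef (fun _ => 1) (INR (S k)) = 0).
  { intros k; apply sin_coef_one, not_0_INR; lia. }
  unfold fejer_mean.
  assert (Hsum : forall m, 2 * PI = sum_n (fun k => fejer_coef n k *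
    (cos_coef (fun _ => 1) (INR k) * cos (INR k * t)
     + sin_coef (fun _ => 1) (INR k) * sin (INR k * t))) m).
  { induction m as [|m IH].
    - rewrite sum_O, H0, Hs0; unfold fejer_coef; simpl INR; simpl fold_weight.
      rewrite Rmult_0_l, cos_0; field; generalize (pos_INR n); lra.
    - rewrite sum_Sn, <- IH, Hk, Hsk; unfold plus; simpl; ring. }
  rewrite <- Hsum; field; lra.
Qed.

Lemma cos_lt_of_far (delta d : R) :
  0 < delta <= PI -> delta <= d <= 2 * PI - delta -> cos d <= cos delta.
Proof.
  intros Hdelta Hd.
  destruct (Rle_dec d PI) as [H|H].
  - apply cos_decr_1; lra.
  - replace (cos d) with (cos (2 * PI - d)).
    + apply cos_decr_1; lra.
    + rewrite cos_minus, cos_2PI, sin_2PI; ring.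
Qed.

(** When [s] and [t] are close modulo [2 * PI], uniform continuity bounds the
    left side by [eps]; otherwise [1 - cos (t - s)] is bounded below and a large
    [C] does it. *)
Lemma periodic_modulus (u : R -> R) (eps : R) :
  (forall x, continuous u x) -> periodic u -> 0 < eps ->
  exists C, 0 <= C /\ forall s t, - PI <= s <= PI -> - PI <= t <= PI ->
    Rabs (u s - u t) <= eps + C * (1 - cos (t - s)).
Proof.
  intros Hu Hper Heps; assert (Hpi := PI_RGT_0).
  destruct (Heine_cor2 (f := u) (a := - (3 * PI)) (b := 3 * PI)
    (fun x _ => proj2 (continuity_pt_filterlim u x) (Hu x)) (mkposreal eps Heps))
    as [delta0 Hdelta0]; simpl in Hdelta0.
  destruct (continuity_ab_maj (fun x => Rabs (u x)) (- PI) PI) as [m [Hm _]]; [lra| |].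
  { intros x _; apply continuity_pt_filterlim.
    apply (continuous_comp u Rabs); [apply Hu | apply continuous_Rabs]. }
  set (B := Rabs (u m)) in *.
  assert (HB : 0 <= B) by apply Rabs_pos.
  set (delta := Rmin delta0 PI).
  assert (Hdelta : 0 < delta <= PI).
  { split; [|apply Rmin_r].
    apply Rmin_glb_lt; [apply cond_pos | exact Hpi]. }
  assert (Hcl : forall x y, - (3 * PI) <= x <= 3 * PI -> - (3 * PI) <= y <= 3 * PI ->
    Rabs (x - y) < delta -> Rabs (u x - u y) <= eps).
  { intros x y Hx Hy Hxy; left; apply Hdelta0; try assumption.
    apply Rlt_le_trans with (1 := Hxy); apply Rmin_l. }
  assert (Hc : cos delta < 1).
  { rewrite <- cos_0; apply cos_decreasing_1; lra. }
  assert (HC : 0 <= 2 * B / (1 - cos delta)) by (apply Rdiv_le_0_compat; lra).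
  exists (2 * B / (1 - cos delta)); split; [exact HC|].
  intros s t Hs Ht.
  assert (Hpos : 0 <= 2 * B / (1 - cos delta) * (1 - cos (t - s))).
  { apply Rmult_le_pos; [exact HC|]; generalize (COS_bound (t - s)); lra. }
  destruct (Rlt_dec (Rabs (t - s)) delta) as [H1|H1].
  { rewrite Rabs_minus_sym in H1.
    assert (H : Rabs (u s - u t) <= eps) by (apply Hcl; lra).
    lra. }
  (* here [s] and [t] lie near opposite ends of [[- PI, PI]]; one is shifted by a period *)
  destruct (Rlt_dec (2 * PI - delta) (t - s)) as [H2|H2].
  { assert (H : Rabs (u (s + 2 * PI) - u t) <= eps).
    { apply Hcl; try lra; apply Rabs_def1; lra. }
    rewrite Hper in H; lra. }
  destruct (Rlt_dec (2 * PI - delta) (s - t)) as [H3|H3].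
  { assert (H : Rabs (u s - u (t + 2 * PI)) <= eps).
    { apply Hcl; try lra; apply Rabs_def1; lra. }
    rewrite Hper in H; lra. }
  assert (Hfar : cos (t - s) <= cos delta).
  { replace (cos (t - s)) with (cos (Rabs (t - s))).
    - apply cos_lt_of_far; [exact Hdelta|].
      split; [lra|apply Rabs_le_between; lra].
    - unfold Rabs; destruct (Rcase_abs (t - s)); [apply cos_neg|reflexivity]. }
  assert (Hb : Rabs (u s - u t) <= 2 * B).
  { generalize (Rabs_triang (u s) (- u t)) (Hm s Hs) (Hm t Ht).
    rewrite Rabs_Ropp; unfold Rminus; lra. }
  assert (HB2 : 2 * B <= 2 * B / (1 - cos delta) * (1 - cos (t - s))).
  { apply Rle_trans with (2 * B / (1 - cos delta) * (1 - cos delta)).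
    - right; field; lra.
    - apply Rmult_le_compat_l; [exact HC|lra]. }
  lra.
Qed.

(** Fejér's theorem.  Since the kernel is nonnegative of mean [1],
    [periodic_modulus] bounds [u t - fejer_mean u n t] by [eps / 2] plus [C] times
    the mean of the kernel against [1 - cos (t - s)], and by [fejer_kernel_mult]
    the latter is at most [2 / (INR n + 1)].  Evaluating the kernel against one
    trigonometric function replaces the usual tail estimate. *)
Lemma fejer_mean_cvg (u : R -> R) (eps : R) :
  (forall x, continuous u x) -> periodic u -> 0 < eps ->
  exists N : nat, forall n : nat, (N <= n)%nat ->
    forall t, - PI <= t <= PI -> Rabs (u t - fejer_mean u n t) <= eps.
Proof.
  intros Hu Hper Heps; assert (Hpi := PI_RGT_0).
  destruct (periodic_modulus u (eps / 2) Hu Hper) as [C [HC Hmod]]; [lra|].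
  destruct (INR_unbounded (4 * C / eps)) as [N HN].
  exists N; intros n Hn t Ht.
  assert (Hn0 := pos_INR n).
  assert (HnN := le_INR _ _ Hn).
  assert (Hone := is_RInt_fejer_mean (fun _ => 1) n t (fun s => continuous_const _ _)).
  rewrite fejer_mean_one in Hone.
  assert (Hfu := is_RInt_fejer_mean u n t Hu).
  assert (Hdiff : is_RInt (fun s => fejer_kernel n (t - s) * (u t - u s)) (- PI) PI
    (2 * PI * (u t - fejer_mean u n t))).
  { apply (is_RInt_ext (fun s => minus (scal (u t) (fejer_kernel n (t - s) * 1))
      (fejer_kernel n (t - s) * u s))).
    { intros s _; unfold minus, plus, opp, scal; simpl; unfold mult; simpl; ring. }
    replace (2 * PI * (u t - fejer_mean u n t))
      with (minus (scal (u t) (2 * PI * 1)) (2 * PI * fejer_mean u n t))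
      by (unfold minus, plus, opp, scal; simpl; unfold mult; simpl; ring).
    apply (is_RInt_minus (V := R_NormedModule)); [|exact Hfu].
    apply (is_RInt_scal (V := R_NormedModule)); exact Hone. }
  assert (Hbound : is_RInt (fun s => eps / 2 * (fejer_kernel n (t - s) * 1)
      + C * (2 / (INR n + 1))) (- PI) PI
    (eps / 2 * (2 * PI * 1) + (PI - - PI) * (C * (2 / (INR n + 1))))).
  { apply (is_RInt_plus (V := R_NormedModule)).
    - apply (is_RInt_scal (V := R_NormedModule) _ _ _ (eps / 2)); exact Hone.
    - apply (is_RInt_const (V := R_NormedModule)). }
  assert (H : Rabs (2 * PI * (u t - fejer_mean u n t))
    <= eps / 2 * (2 * PI * 1) + (PI - - PI) * (C * (2 / (INR n + 1)))).
  { refine (norm_RInt_le (V := R_NormedModule) _ _ (- PI) PI _ _ _ _ Hdiff Hbound); [lra|].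
    intros s Hs.
    change (Rabs (fejer_kernel n (t - s) * (u t - u s))
      <= eps / 2 * (fejer_kernel n (t - s) * 1) + C * (2 / (INR n + 1))).
    assert (HK := fejer_kernel_pos n (t - s)).
    rewrite Rabs_mult, (Rabs_right (fejer_kernel n (t - s))), Rabs_minus_sym by lra.
    apply Rle_trans with
      (fejer_kernel n (t - s) * (eps / 2 + C * (1 - cos (t - s)))).
    - apply Rmult_le_compat_l; [exact HK|now apply Hmod].
    - rewrite Rmult_plus_distr_l, <- Rmult_assoc.
      rewrite (Rmult_comm (fejer_kernel n (t - s)) C), Rmult_assoc, fejer_kernel_mult.
      apply Rplus_le_compat; [right; ring|].
      apply Rmult_le_compat_l; [exact HC|].
      apply Rmult_le_compat_r; [left; apply Rinv_0_lt_compat; lra|].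
      generalize (COS_bound ((INR n + 1) * (t - s))); lra. }
  rewrite Rabs_mult, (Rabs_right (2 * PI)) in H by lra.
  assert (Hlast : C * (2 / (INR n + 1)) <= eps / 2).
  { apply (Rmult_le_reg_r (INR n + 1)); [lra|].
    replace (C * (2 / (INR n + 1)) * (INR n + 1)) with (2 * C) by (field; lra).
    apply (Rmult_le_reg_r (2 / eps)); [apply Rdiv_lt_0_compat; lra|].
    replace (eps / 2 * (INR n + 1) * (2 / eps)) with (INR n + 1) by (field; lra).
    replace (2 * C * (2 / eps)) with (4 * C / eps) by (field; lra).
    lra. }
  apply (Rmult_le_reg_l (2 * PI)); [lra|].
  apply Rle_trans with (1 := H).
  replace (eps / 2 * (2 * PI * 1) + (PI - - PI) * (C * (2 / (INR n + 1))))
    with (2 * PI * (eps / 2 + C * (2 / (INR n + 1)))) by (field; lra).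
  apply Rmult_le_compat_l; lra.
Qed.

(** * Fourier coefficients of the distribution *)

Lemma Bc_shift (F : R -> R) (x : R) : Bc F -> F (x + 2 * PI) = F x + F PI.
Proof.
  intros [_ [_ HF]]; assert (Hpi := PI_RGT_0).
  pose (n := Int_part ((x + PI) / (2 * PI))).
  destruct (base_Int_part ((x + PI) / (2 * PI))) as [H1 H2]; fold n in H1, H2.
  pose (y := x - 2 * IZR n * PI).
  assert (Hn : x + PI = (x + PI) / (2 * PI) * (2 * PI)) by (field; lra).
  assert (Hy : - PI <= y < PI).
  { split.
    - apply (Rmult_le_compat_r (2 * PI)) in H1; unfold y; lra.
    - assert (H3 : (x + PI) / (2 * PI) < IZR n + 1) by lra.
      apply (Rmult_lt_compat_r (2 * PI)) in H3; unfold y; lra. }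
  replace (x + 2 * PI) with (y + 2 * IZR (n + 1) * PI)
    by (unfold y; rewrite plus_IZR; ring).
  replace (F x) with (F (y + 2 * IZR n * PI)) by (f_equal; unfold y; ring).
  rewrite !HF, plus_IZR by exact Hy; ring.
Qed.

(** [F] gains [F PI] over each period, so subtracting the linear function with
    the same gain leaves a periodic function; the shift [t + PI] keeps the value
    [0] at [- PI]. *)
Definition periodic_part (F : R -> R) (t : R) : R := F t - F PI / (2 * PI) * (t + PI).

Lemma periodic_part_periodic (F : R -> R) : Bc F -> periodic (periodic_part F).
Proof.
  intros HF x; unfold periodic_part; rewrite (Bc_shift F x HF).
  field; apply PI_neq0.
Qed.

Lemma continuous_periodic_part (F : R -> R) :
  (forall x, continuous F x) -> forall x, continuous (periodic_part F) x.
Proof.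
  intros HF x; apply (continuous_minus F); [apply HF|].
  apply (ex_derive_continuous (fun t => F PI / (2 * PI) * (t + PI))).
  auto_derive; exact I.
Qed.

Lemma distr_primitive_Bc (f : distribution) : Ac f -> Bc (distr_primitive f).
Proof.
  intros Hf.
  exact (proj1 (epsilon_spec (inhabits (fun _ : R => 0))
    (fun F => Bc F /\ is_distr_derivative F f) Hf)).
Qed.

(** Integration by parts, separately on the two parts of the primitive: the
    linear part contributes its slope times the integral of [h], and for the
    periodic part the boundary term [F PI * h PI] has been absorbed by the linear
    one. *)
Lemma cpint_C1 (f : distribution) (h dh : R -> R) :
  Ac f -> (forall x, is_derive h x (dh x)) -> (forall x, continuous dh x) ->
  cpint f h = distr_primitive f PI / (2 * PI) * RInt h (- PI) PI
    - RInt (fun s => periodic_part (distr_primitive f) s * dh s) (- PI) PI.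
Proof.
  intros Hf Hh Hdh; assert (Hpi := PI_RGT_0).
  destruct (distr_primitive_Bc f Hf) as [HF _].
  unfold cpint; set (F := distr_primitive f) in *.
  assert (Hhc : forall x, continuous h x).
  { intros x; apply (ex_derive_continuous h); exists (dh x); apply Hh. }
  rewrite (RSInt_unique F h (- PI) PI (RInt (fun s => F s * dh s) (- PI) PI)).
  2: { apply is_RSInt_C1; try assumption; lra. }
  assert (Hparts : is_RInt (fun s => h s + (s + PI) * dh s) (- PI) PI (2 * PI * h PI)).
  { replace (2 * PI * h PI) with ((PI + PI) * h PI - (- PI + PI) * h (- PI)) by ring.
    apply (is_RInt_derive (V := R_CompleteNormedModule) (fun s => (s + PI) * h s)).
    - intros s _; auto_derive; [exists (dh s); apply Hh|].
      replace (Derive (fun x => h x) s) with (dh s)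
        by (symmetry; apply is_derive_unique, Hh); ring.
    - intros s _; apply (continuous_plus h); [apply Hhc|].
      apply (continuous_mult (fun s => s + PI)); [|apply Hdh].
      apply (ex_derive_continuous (fun s => s + PI)); auto_derive; exact I. }
  assert (HP := continuous_periodic_part F HF).
  assert (HIP := RInt_correct (V := R_CompleteNormedModule)
    (fun s => periodic_part F s * dh s) (- PI) PI
    (ex_RInt_continuous (V := R_CompleteNormedModule) _ _ _
      (fun s _ => continuous_mult (periodic_part F) dh s (HP s) (Hdh s)))).
  assert (HIh := RInt_correct (V := R_CompleteNormedModule) h (- PI) PI
    (ex_RInt_continuous (V := R_CompleteNormedModule) _ _ _ (fun s _ => Hhc s))).
  set (IP := RInt (fun s => periodic_part F s * dh s) (- PI) PI) in *.
  set (Ih := RInt h (- PI) PI) in *.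
  assert (HFdh : is_RInt (fun s => F s * dh s) (- PI) PI
    (IP + F PI / (2 * PI) * (2 * PI * h PI - Ih))).
  { apply (is_RInt_ext (fun s => plus (periodic_part F s * dh s)
      (scal (F PI / (2 * PI)) (minus (h s + (s + PI) * dh s) (h s))))).
    - intros s _; unfold periodic_part, minus, plus, opp, scal; simpl; unfold mult; simpl; ring.
    - apply (is_RInt_plus (V := R_NormedModule)); [exact HIP|].
      apply (is_RInt_scal (V := R_NormedModule)).
      apply (is_RInt_minus (V := R_NormedModule)); [exact Hparts|exact HIh]. }
  rewrite (is_RInt_unique _ _ _ _ HFdh); field; lra.
Qed.

Lemma fourier_distr_eq (f : distribution) (k : Z) :
  Ac f ->
  fourier_distr f k =
    (distr_primitive f PI / (2 * PI) * cos_coef (fun _ => 1) (IZR k)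
       + IZR k * sin_coef (periodic_part (distr_primitive f)) (IZR k),
     - (distr_primitive f PI / (2 * PI) * sin_coef (fun _ => 1) (IZR k))
       + IZR k * cos_coef (periodic_part (distr_primitive f)) (IZR k)).
Proof.
  intros Hf.
  destruct (distr_primitive_Bc f Hf) as [HF _].
  assert (HP := continuous_periodic_part _ HF).
  set (P := periodic_part (distr_primitive f)) in *.
  unfold fourier_distr, cpintC, expi; simpl Re; simpl Im.
  f_equal.
  - rewrite (cpint_C1 f (fun t => cos (- (IZR k * t))) (fun t => - IZR k * sin (IZR k * t)) Hf).
    + fold P.
      rewrite (is_RInt_unique (fun s => P s * (- IZR k * sin (IZR k * s))) (- PI) PI
        (- IZR k * sin_coef P (IZR k))).
      * rewrite (RInt_ext _ (fun s => 1 * cos (IZR k * s))); [unfold cos_coef; ring|].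
        intros s _; now rewrite cos_neg, Rmult_1_l.
      * apply (is_RInt_ext (fun s => scal (- IZR k) (P s * sin (IZR k * s)))).
        { intros s _; unfold scal; simpl; unfold mult; simpl; ring. }
        apply (is_RInt_scal (V := R_NormedModule)); now apply is_RInt_sin_coef.
    + intros x; auto_derive; [exact I|rewrite sin_neg; ring].
    + intros x; apply (continuous_mult (fun _ => - IZR k));
        [apply continuous_const|apply continuous_sin_mult].
  - rewrite (cpint_C1 f (fun t => sin (- (IZR k * t))) (fun t => - IZR k * cos (IZR k * t)) Hf).
    + fold P.
      rewrite (is_RInt_unique (fun s => P s * (- IZR k * cos (IZR k * s))) (- PI) PI
        (- IZR k * cos_coef P (IZR k))).
      * rewrite (is_RInt_unique (fun s => sin (- (IZR k * s))) (- PI) PI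
          (- sin_coef (fun _ => 1) (IZR k))); [ring|].
        apply (is_RInt_ext (fun s => opp (1 * sin (IZR k * s)))).
        { intros s _; rewrite sin_neg; unfold opp; simpl; ring. }
        apply (is_RInt_opp (V := R_NormedModule)); apply is_RInt_sin_coef.
        intros s; apply continuous_const.
      * apply (is_RInt_ext (fun s => scal (- IZR k) (P s * cos (IZR k * s)))).
        { intros s _; unfold scal; simpl; unfold mult; simpl; ring. }
        apply (is_RInt_scal (V := R_NormedModule)); now apply is_RInt_cos_coef.
    + intros x; auto_derive; [exact I|rewrite cos_neg; ring].
    + intros x; apply (continuous_mult (fun _ => - IZR k));
        [apply continuous_const|apply continuous_cos_mult].
Qed.

(** * Fourier coefficients of the function of bounded variation *)

Lemma lipschitz_of_derive (h dh : R -> R) (L x y : R) :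
  (forall z, is_derive h z (dh z)) -> (forall z, Rabs (dh z) <= L) ->
  x <= y -> Rabs (h y - h x) <= L * (y - x).
Proof.
  intros Hh HL Hxy.
  destruct (MVT_gen h x y dh) as [c [_ Hc]].
  - intros z _; apply Hh.
  - intros z _; apply continuity_pt_filterlim, (ex_derive_continuous h).
    exists (dh z); apply Hh.
  - rewrite Hc, Rabs_mult, (Rabs_right (y - x)) by lra.
    apply Rmult_le_compat_r; [lra|apply HL].
Qed.

Lemma increments_dominated_trig (g v : R -> R) (x a b : R) :
  increments_dominated g v a b ->
  (exists w, increments_dominated (fun s => g s * cos (x * s)) w a b) /\
  (exists w, increments_dominated (fun s => g s * sin (x * s)) w a b).
Proof.
  intros Hg; assert (Hx := Rabs_pos x).
  split.
  - eexists.
    apply (increments_dominated_mult g v (fun s => cos (x * s)) a b 1 (Rabs x) Hx Hg).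
    + intros s; apply Rabs_le_between; generalize (COS_bound (x * s)); lra.
    + intros s t; apply (lipschitz_of_derive (fun s => cos (x * s)) (fun s => - x * sin (x * s))).
      * intros z; auto_derive; [exact I|ring].
      * intros z; rewrite Rabs_mult, Rabs_Ropp.
        rewrite <- (Rmult_1_r (Rabs x)) at 2.
        apply Rmult_le_compat_l; [exact Hx|].
        apply Rabs_le_between; generalize (SIN_bound (x * z)); lra.
  - eexists.
    apply (increments_dominated_mult g v (fun s => sin (x * s)) a b 1 (Rabs x) Hx Hg).
    + intros s; apply Rabs_le_between; generalize (SIN_bound (x * s)); lra.
    + intros s t; apply (lipschitz_of_derive (fun s => sin (x * s)) (fun s => x * cos (x * s))).
      * intros z; auto_derive; [exact I|ring].
      * intros z; rewrite Rabs_mult.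
        rewrite <- (Rmult_1_r (Rabs x)) at 2.
        apply Rmult_le_compat_l; [exact Hx|].
        apply Rabs_le_between; generalize (COS_bound (x * z)); lra.
Qed.

Lemma is_RInt_trig (g v : R -> R) (x : R) :
  increments_dominated g v (- PI) PI ->
  is_RInt (fun s => g s * cos (x * s)) (- PI) PI (cos_coef g x) /\
  is_RInt (fun s => g s * sin (x * s)) (- PI) PI (sin_coef g x).
Proof.
  intros Hg; assert (Hpi := PI_RGT_0).
  destruct (increments_dominated_trig g v x (- PI) PI Hg) as [[w1 H1] [w2 H2]].
  split; apply (RInt_correct (V := R_CompleteNormedModule)).
  - apply (ex_RInt_dominated _ w1); [lra|exact H1].
  - apply (ex_RInt_dominated _ w2); [lra|exact H2].
Qed.

Lemma Cconj_fourier_fun (g v : R -> R) (k : Z) :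
  increments_dominated g v (- PI) PI ->
  Cconj (fourier_fun g k) = (cos_coef g (IZR k), sin_coef g (IZR k)).
Proof.
  intros Hg; destruct (is_RInt_trig g v (IZR k) Hg) as [_ Hs].
  unfold fourier_fun, RIntC, expi, Cconj; simpl.
  f_equal.
  - apply RInt_ext; intros t _.
    now rewrite cos_neg, Rmult_0_l, Rminus_0_r.
  - rewrite (is_RInt_unique _ (- PI) PI (- sin_coef g (IZR k))); [ring|].
    apply (is_RInt_ext (fun t => opp (g t * sin (IZR k * t)))).
    + intros t _; rewrite sin_neg; unfold opp; simpl; ring.
    + apply (is_RInt_opp (V := R_NormedModule)); exact Hs.
Qed.

(** * Symmetric sums *)

Lemma cos_coef_neg (u : R -> R) (x : R) : cos_coef u (- x) = cos_coef u x.
Proof.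
  apply RInt_ext; intros s _.
  now rewrite <- Ropp_mult_distr_l, cos_neg.
Qed.

Lemma sin_coef_neg (u : R -> R) (x : R) :
  ex_RInt (fun s => u s * sin (x * s)) (- PI) PI -> sin_coef u (- x) = - sin_coef u x.
Proof.
  intros Hu; apply is_RInt_unique.
  apply (is_RInt_ext (fun s => opp (u s * sin (x * s)))).
  - intros s _; rewrite <- Ropp_mult_distr_l, sin_neg; unfold opp; simpl; ring.
  - apply (is_RInt_opp (V := R_NormedModule)).
    now apply (RInt_correct (V := R_CompleteNormedModule)).
Qed.

Lemma sum_sym_S (a : Z -> C) (n : nat) :
  sum_sym a (S n) = (sum_sym a n + (a (Z.of_nat (S n)) + a (- Z.of_nat (S n))%Z))%C.
Proof.
  unfold sum_sym.
  replace (2 * S n)%nat with (S (S (2 * n))) by lia.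
  rewrite sum_Sn; unfold sum_n at 1.
  rewrite sum_Sn_m by lia.
  rewrite <- sum_n_m_S.
  rewrite (sum_n_m_ext (fun j => a (Z.of_nat (S j) - Z.of_nat (S n))%Z)
    (fun j => a (Z.of_nat j - Z.of_nat n)%Z)) by (intros j; f_equal; lia).
  fold (sum_n (fun j => a (Z.of_nat j - Z.of_nat n)%Z) (2 * n)).
  replace (Z.of_nat (S (S (2 * n))) - Z.of_nat (S n))%Z with (Z.of_nat (S n)) by lia.
  replace (Z.of_nat 0 - Z.of_nat (S n))%Z with (- Z.of_nat (S n))%Z by lia.
  do 2 change (plus ?p ?q) with (Cplus p q).
  ring.
Qed.

(** The terms of index [k] and [- k] are added, which is where imaginary parts
    cancel; at [k = 0] the hypothesis counts the term twice, as the factor [2]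
    does. *)
Lemma sum_sym_fold (a : Z -> C) (r : nat -> R) (n : nat) :
  (forall k : nat, (a (Z.of_nat k) + a (- Z.of_nat k)%Z)%C = RtoC (2 * r k)) ->
  sum_sym a n = RtoC (sum_n (fun k => fold_weight k * r k) n).
Proof.
  intros Ha; induction n as [|n IH].
  - unfold sum_sym; simpl (2 * 0)%nat; rewrite !sum_O.
    generalize (Ha 0%nat); simpl; destruct (a 0%Z) as [p q].
    unfold Cplus, RtoC; simpl; intros H; injection H; intros H1 H2.
    f_equal; lra.
  - rewrite sum_sym_S, IH, Ha, sum_Sn.
    change (plus ?p ?q) with (p + q); simpl fold_weight; now rewrite RtoC_plus.
Qed.

(** * The Cesàro sums as integrals of the function against a smooth density *)

Lemma is_derive_fejer_mean (u : R -> R) (n : nat) (t : R) :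
  is_derive (fejer_mean u n) t (/ (2 * PI) * sum_n (fun k => fejer_coef n k *
    (INR k * (sin_coef u (INR k) * cos (INR k * t)
              - cos_coef u (INR k) * sin (INR k * t)))) n).
Proof.
  unfold fejer_mean.
  apply (is_derive_scal (fun t => sum_n (fun k => fejer_coef n k *
    (cos_coef u (INR k) * cos (INR k * t) + sin_coef u (INR k) * sin (INR k * t))) n)).
  apply (is_derive_sum_n (fun k t => fejer_coef n k *
    (cos_coef u (INR k) * cos (INR k * t) + sin_coef u (INR k) * sin (INR k * t)))).
  intros k _; auto_derive; [exact I|ring].
Qed.

Lemma continuous_sum_n (f : nat -> R -> R) (n : nat) (x : R) :
  (forall k, continuous (f k) x) -> continuous (fun y => sum_n (fun k => f k y) n) x.
Proof.
  intros Hf; induction n as [|n IH].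
  - apply (continuous_ext (f 0%nat)); [intros y; now rewrite sum_O|apply Hf].
  - apply (continuous_ext (fun y => plus (sum_n (fun k => f k y) n) (f (S n) y))).
    + intros y; now rewrite sum_Sn.
    + apply (continuous_plus (V := R_NormedModule)); [exact IH|apply Hf].
Qed.

(** Only the periodic part is averaged: a Fejér mean of the linear part would see
    its jump from one period to the next and lose uniform convergence. *)
Definition mean_primitive (F : R -> R) (n : nat) (t : R) : R :=
  F PI / (2 * PI) * (t + PI) + fejer_mean (periodic_part F) n t.

(** For integer [x], [cos_term F x] and [- sin_term F x] are the real and imaginary
    parts of the Fourier coefficient at [x] of the derivative of [F]. *)
Definition cos_term (F : R -> R) (x : R) : R :=
  F PI / (2 * PI) * cos_coef (fun _ => 1) x + x * sin_coef (periodic_part F) x.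

Definition sin_term (F : R -> R) (x : R) : R :=
  F PI / (2 * PI) * sin_coef (fun _ => 1) x - x * cos_coef (periodic_part F) x.

Definition mean_density (F : R -> R) (n : nat) (t : R) : R :=
  / (2 * PI) * sum_n (fun k => fejer_coef n k *
    (cos_term F (INR k) * cos (INR k * t) + sin_term F (INR k) * sin (INR k * t))) n.

(** The slope [c] of the linear part is written as [c] times the Fejér mean of
    the constant [1], so that both parts become the same kind of trigonometric
    sum. *)
Lemma is_derive_mean_primitive (F : R -> R) (n : nat) (t : R) :
  is_derive (mean_primitive F n) t (mean_density F n t).
Proof.
  set (c := F PI / (2 * PI)).
  set (P := periodic_part F).
  assert (E : mean_density F n t = c * fejer_mean (fun _ => 1) n t
    + / (2 * PI) * sum_n (fun k => fejer_coef n k *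
      (INR k * (sin_coef P (INR k) * cos (INR k * t)
                - cos_coef P (INR k) * sin (INR k * t)))) n).
  { unfold mean_density, fejer_mean.
    rewrite <- Rmult_assoc, (Rmult_comm c), Rmult_assoc, <- Rmult_plus_distr_l.
    f_equal.
    change (?p * sum_n ?q n) with (mult p (sum_n q n)).
    rewrite <- (sum_n_mult_l (K := R_Ring)).
    change (sum_n ?p n + sum_n ?q n)
      with (@plus R_AbelianMonoid (sum_n p n) (sum_n q n)).
    rewrite <- sum_n_plus.
    apply sum_n_ext; intros k; unfold cos_term, sin_term.
    fold c P; unfold plus, mult; simpl; ring. }
  rewrite E, fejer_mean_one.
  apply (is_derive_plus (fun t => c * (t + PI)) (fejer_mean P n)).
  - auto_derive; [exact I|ring].
  - apply is_derive_fejer_mean.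
Qed.

Lemma continuous_mean_density (F : R -> R) (n : nat) (t : R) :
  continuous (mean_density F n) t.
Proof.
  apply (continuous_mult (fun _ => / (2 * PI))); [apply continuous_const|].
  apply continuous_sum_n; intros k.
  apply (ex_derive_continuous (fun t => fejer_coef n k *
    (cos_term F (INR k) * cos (INR k * t) + sin_term F (INR k) * sin (INR k * t)))).
  auto_derive; exact I.
Qed.

Lemma is_RInt_mean_density (F g v : R -> R) (n : nat) :
  increments_dominated g v (- PI) PI ->
  is_RInt (fun t => g t * mean_density F n t) (- PI) PI
    (/ (2 * PI) * sum_n (fun k => fejer_coef n k *
      (cos_term F (INR k) * cos_coef g (INR k)
       + sin_term F (INR k) * sin_coef g (INR k))) n).
Proof.
  intros Hg.
  apply (is_RInt_ext (fun t => scal (/ (2 * PI)) (sum_n (fun k =>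
    scal (fejer_coef n k) (plus (scal (cos_term F (INR k)) (g t * cos (INR k * t)))
      (scal (sin_term F (INR k)) (g t * sin (INR k * t))))) n))).
  - intros t _; unfold mean_density.
    rewrite (Rmult_comm (g t)), Rmult_assoc.
    change (scal ?p ?q) with (p * q); f_equal.
    change (?q * g t) with (mult q (g t)).
    rewrite <- (sum_n_mult_r (K := R_Ring)).
    apply sum_n_ext; intros k; unfold plus, mult, scal; simpl; unfold mult; simpl; ring.
  - apply (is_RInt_scal (V := R_NormedModule)).
    apply is_RInt_sum_n; intros k.
    destruct (is_RInt_trig g v (INR k) Hg) as [Hc Hs].
    apply (is_RInt_scal (V := R_NormedModule)).
    apply (is_RInt_plus (V := R_NormedModule));
      apply (is_RInt_scal (V := R_NormedModule)); assumption.
Qed.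

(** In the product of the coefficients at [k] the real part is even in [k] and
    the imaginary part odd. *)
Lemma fejer_sum_eq (f : distribution) (g : R -> R) (n : nat) :
  Ac f -> BV g ->
  (RtoC (/ (2 * PI)) * sum_sym (fun k : Z =>
     RtoC (1 - Rabs (IZR k) / (INR n + 1)) *
     fourier_distr f k * Cconj (fourier_fun g k)) n)%C
  = RtoC (RInt (fun t => g t * mean_density (distr_primitive f) n t) (- PI) PI).
Proof.
  intros Hf Hg.
  destruct (BV_increments_dominated g Hg) as [v Hv].
  set (F := distr_primitive f).
  assert (HP : forall x, continuous (periodic_part F) x).
  { apply continuous_periodic_part; apply (distr_primitive_Bc f Hf). }
  rewrite (sum_sym_fold _ (fun k => (1 - INR k / (INR n + 1)) *
    (cos_term F (INR k) * cos_coef g (INR k) + sin_term F (INR k) * sin_coef g (INR k)))).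
  - rewrite (is_RInt_unique _ _ _ _ (is_RInt_mean_density F g v n Hv)).
    rewrite <- RtoC_mult; f_equal; f_equal.
    apply sum_n_ext; intros k; symmetry; apply Rmult_assoc.
  - intros k.
    rewrite !(fourier_distr_eq f) by exact Hf.
    rewrite !(Cconj_fourier_fun g v) by exact Hv.
    rewrite opp_IZR, Rabs_Ropp, <- INR_IZR_INZ, (Rabs_right (INR k))
      by (apply Rle_ge, pos_INR).
    fold F.
    rewrite !cos_coef_neg, (sin_coef_neg g), (sin_coef_neg (periodic_part F)),
      (sin_coef_neg (fun _ => 1)).
    + unfold cos_term, sin_term, Cplus, Cmult, RtoC; simpl; f_equal; ring.
    + eexists; apply is_RInt_sin_coef; intros s; apply continuous_const.
    + eexists; now apply is_RInt_sin_coef.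
    + eexists; exact (proj2 (is_RInt_trig g v (INR k) Hv)).
Qed.

Theorem theorem18 (f : distribution) (g : R -> R) (hf : Ac f) (hg : BV g) :
  filterlim
    (fun n : nat =>
       (RtoC (/ (2 * PI)) *
        sum_sym (fun k : Z =>
          RtoC (1 - Rabs (IZR k) / (INR n + 1)) *
          fourier_distr f k * Cconj (fourier_fun g k)) n)%C)
    eventually (locally (RtoC (cpint f g))).
Proof.
  assert (Hpi := PI_RGT_0).
  destruct (distr_primitive_Bc f hf) as [HF [HF0 _]].
  assert (HFper := periodic_part_periodic _ (distr_primitive_Bc f hf)).
  unfold cpint.
  apply (filterlim_ext (fun n =>
    RtoC (RInt (fun t => g t * mean_density (distr_primitive f) n t) (- PI) PI))).
  { intros n; symmetry; now apply fejer_sum_eq. }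
  set (F := distr_primitive f) in *.
  destruct (BV_increments_dominated g hg) as [v Hv].
  set (S := fun n => RInt (fun t => g t * mean_density F n t) (- PI) PI).
  set (Phi := mean_primitive F).
  assert (Hunif : forall eps : R, 0 < eps -> exists N : nat, forall n : nat, (N <= n)%nat ->
    forall t, - PI <= t <= PI -> Rabs (F t - Phi n t) <= eps).
  { intros eps Heps.
    destruct (fejer_mean_cvg (periodic_part F) eps) as [N HN]; try assumption.
    { now apply continuous_periodic_part. }
    exists N; intros n Hn t Ht.
    replace (F t - Phi n t) with (periodic_part F t - fejer_mean (periodic_part F) n t)
      by (unfold Phi, mean_primitive, periodic_part; ring).
    now apply HN. }
  assert (HI : forall n, is_RSInt (Phi n) g (- PI) PI
    (Phi n PI * g PI - Phi n (- PI) * g (- PI) - S n)).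
  { intros n; apply (is_RSInt_by_parts g v (Phi n) (mean_density F n)); [lra|exact Hv| | |].
    - apply is_derive_mean_primitive.
    - apply continuous_mean_density.
    - eexists; now apply is_RInt_mean_density with v. }
  destruct (is_RSInt_uniform_limit F g v Phi _ (- PI) PI ltac:(lra) Hv HI Hunif)
    as [L [HL HlimI]].
  rewrite (RSInt_unique _ _ _ _ _ HL).
  assert (Hpt : forall t, - PI <= t <= PI -> is_lim_seq (fun n => Phi n t) (F t)).
  { intros t Ht; apply is_lim_seq_spec; intros eps.
    destruct (Hunif (eps / 2)) as [N HN]; [generalize (cond_pos eps); lra|].
    exists N; intros n Hn; rewrite Rabs_minus_sym.
    generalize (HN n Hn t Ht) (cond_pos eps); lra. }
  (* [S n] is the boundary terms of [Phi n] minus its Stieltjes integral *)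
  assert (HS : is_lim_seq S (F PI * g PI - L)).
  { apply (is_lim_seq_ext (fun n => Phi n PI * g PI - Phi n (- PI) * g (- PI)
      - (Phi n PI * g PI - Phi n (- PI) * g (- PI) - S n))); [intros n; ring|].
    replace (F PI * g PI - L) with (F PI * g PI - F (- PI) * g (- PI) - L)
      by (rewrite HF0; ring).
    apply is_lim_seq_minus'; [|exact HlimI].
    apply is_lim_seq_minus'; (apply is_lim_seq_mult'; [|apply is_lim_seq_const]);
      apply Hpt; lra. }
  apply filterlim_locally; intros eps.
  generalize (proj1 (filterlim_locally _ _) HS eps); apply filter_imp.
  intros n Hn; split; [exact Hn|apply ball_center].
Qed.
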